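(* Consider the semi-discrete path-conservative central-upwind (PCCU) scheme for the two-dimensional augmented Godunov–Powell ideal MHD system, as fully specified in the context. Let $\overline{\boldsymbol U}_{j,k}(t)$, $t\in[0,T]$, be a solution of the scheme (a system of ODEs in $t$), and let $((b_1)_x)_{j,k}$ and $((b_2)_y)_{j,k}$ be the slopes of $b_1$ in the $x$-direction and of $b_2$ in the $y$-direction used in its piecewise linear reconstruction, i.e. $((b_1)_x)_{j,k}=\sigma_{j,k}\overline A_{j,k}$ and $((b_2)_y)_{j,k}=\sigma_{j,k}\overline B_{j,k}$. If the discrete divergence-free condition is satisfied initially, i.e. $\overline A_{j,k}(0)+\overline B_{j,k}(0)=0$ for all $j,k$, then the local divergence-free condition $$\big((b_1)_x\big)_{j,k}+\big((b_2)_y\big)_{j,k}=0$$ holds for all $j,k$ and at all times $t\in[0,T]$.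
   Context: **Unknowns and fluxes.** $\boldsymbol U=(\rho,\rho u,\rho v,\rho w,b_1,b_2,b_3,\mathcal E,A,B)^\top$, where $\rho$ is the density, $\boldsymbol u=(u,v,w)^\top$ the velocity, $\boldsymbol b=(b_1,b_2,b_3)^\top$ the magnetic field, $\mathcal E$ the total energy, and $A,B$ are auxiliary unknowns standing for $(b_1)_x$ and $(b_2)_y$. The pressure $p$ is given by $\mathcal E=\frac{p}{\gamma-1}+\frac{\rho}{2}|\boldsymbol u|^2+\frac12|\boldsymbol b|^2$ with a constant $\gamma>1$; $|\cdot|$ is the Euclidean norm. The augmented system is $\boldsymbol U_t+\boldsymbol F(\boldsymbol U)_x+\boldsymbol G(\boldsymbol U)_y=Q(\boldsymbol U)\boldsymbol U_x+R(\boldsymbol U)\boldsymbol U_y$ with $$\boldsymbol F=\big(\rho u,\ \rho u^2+p+\tfrac12|\boldsymbol b|^2-b_1^2,\ \rho uv-b_1b_2,\ \rho uw-b_1b_3,\ 0,\ ub_2-vb_1,\ ub_3-wb_1,\ (\mathcal E+p+\tfrac12|\boldsymbol b|^2)u-(\boldsymbol u\cdot\boldsymbol b)b_1,\ uA-b_2u_y,\ uB+b_2u_y\big)^\top,$$ $$\boldsymbol G=\big(\rho v,\ \rho uv-b_1b_2,\ \rho v^2+p+\tfrac12|\boldsymbol b|^2-b_2^2,\ \rho vw-b_2b_3,\ vb_1-ub_2,\ 0,\ vb_3-wb_2,\ (\mathcal E+p+\tfrac12|\boldsymbol b|^2)v-(\boldsymbol u\cdot\boldsymbol b)b_2,\ vA+b_1v_x,\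 vB-b_1v_x\big)^\top,$$ $Q(\boldsymbol U)\boldsymbol U_x=\boldsymbol q\,(b_1)_x$ and $R(\boldsymbol U)\boldsymbol U_y=\boldsymbol q\,(b_2)_y$, where $\boldsymbol q=(0,-b_1,-b_2,-b_3,-u,-v,-w,-\boldsymbol u\cdot\boldsymbol b,0,0)^\top$. **Mesh.** A uniform Cartesian mesh of finitely many cells $C_{j,k}=[x_{j-1/2},x_{j+1/2}]\times[y_{k-1/2},y_{k+1/2}]$ of size $\Delta x\times\Delta y$ and with center $(x_j,y_k)$ covers a rectangle. In each direction either periodic or free (zero-order extrapolation) boundary conditions are imposed: cell values at indices outside the mesh are obtained by wrapping the index periodically, or by replacing it with the nearest index in the mesh, respectively, and all formulas below are also applied in these ghost cells where needed. $\overline{\boldsymbol U}_{j,k}(t)$ denote the computed cell averages, and $\overline A_{j,k},\overline B_{j,k}$ are their ninth and tenth components. **Reconstruction.** From $\overline{\boldsymbol U}_{j,k}$ set $u_{j,k}=\overline{(\rho u)}_{j,k}/\overline\rho_{j,k}$, $v_{j,k}=\overline{(\rho v)}_{j,k}/\overline\rho_{j,k}$, $w_{j,k}=\overline{(\rho w)}_{j,k}/\overline\rho_{j,k}$, obtain $p_{j,k}$ from the equation of state applied to these values and the cell averages, and put $$\boldsymbol W_{j,k}=(\overline\rho,u,v,w,\overline{b_1},\overline{b_2},\overline{b_3},p,\overline A,\overline B)^\top_{j,k}.$$ The piecewise linear reconstruction is $\widetilde{\boldsymbol W}(x,y)=\boldsymbol W_{j,k}+(\boldsymbol W_x)_{j,k}(x-x_j)+(\boldsymbol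 W_y)_{j,k}(y-y_k)$ on $C_{j,k}$, with interface values $\boldsymbol W^{E,W}_{j,k}=\boldsymbol W_{j,k}\pm\frac{\Delta x}{2}(\boldsymbol W_x)_{j,k}$ and $\boldsymbol W^{N,S}_{j,k}=\boldsymbol W_{j,k}\pm\frac{\Delta y}{2}(\boldsymbol W_y)_{j,k}$ ($+$ for $E,N$; $-$ for $W,S$). With a fixed parameter $\theta>0$, the generalized minmod slopes of a component $W^{(i)}$ are $$\mathrm{minmod}\Big(\theta\tfrac{W^{(i)}_{j,k}-W^{(i)}_{j-1,k}}{\Delta x},\tfrac{W^{(i)}_{j+1,k}-W^{(i)}_{j-1,k}}{2\Delta x},\theta\tfrac{W^{(i)}_{j+1,k}-W^{(i)}_{j,k}}{\Delta x}\Big)$$ in $x$ and analogously in $y$ (differences in $k$, divided by $\Delta y$), where $\mathrm{minmod}(a_1,a_2,\dots)$ equals $\mathrm{sgn}(a_1)\min_k|a_k|$ if all $a_k$ are positive or all are negative, and $0$ otherwise. All slopes $(W^{(i)}_x)_{j,k}$, $i\neq5$, and $(W^{(i)}_y)_{j,k}$, $i\ne6$, are these generalized minmod slopes. The two exceptional slopes are $$((b_1)_x)_{j,k}=\sigma_{j,k}\overline A_{j,k},\qquad((b_2)_y)_{j,k}=\sigma_{j,k}\overline B_{j,k},\qquad\sigma_{j,k}=\min\{1,\sigma^x_{j,k},\sigma^y_{j,k}\}.$$ Here, with $(\widehat{(b_1)}_x)_{j,k}$ and $(\widehat{(b_2)}_y)_{j,k}$ denoting the generalized minmod slopes of $b_1$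 in $x$ and of $b_2$ in $y$: $\sigma^x_{j,k}=\min\{1,(\widehat{(b_1)}_x)_{j,k}/\overline A_{j,k}\}$ if $(\widehat{(b_1)}_x)_{j,k}\overline A_{j,k}>0$ and $\sigma^x_{j,k}=0$ otherwise; $\sigma^y_{j,k}=\min\{1,(\widehat{(b_2)}_y)_{j,k}/\overline B_{j,k}\}$ if $(\widehat{(b_2)}_y)_{j,k}\overline B_{j,k}>0$ and $\sigma^y_{j,k}=0$ otherwise. The conservative interface values $\boldsymbol U^{E,W,N,S}_{j,k}$ are obtained from $\boldsymbol W^{E,W,N,S}_{j,k}$, with $\mathcal E$ given by the equation of state. In evaluating $\boldsymbol F(\boldsymbol U^{E}_{j,k})$ and $\boldsymbol F(\boldsymbol U^{W}_{j,k})$ one uses for $u_y$ the minmod slope $(u_y)_{j,k}$; in evaluating $\boldsymbol G(\boldsymbol U^{N}_{j,k})$ and $\boldsymbol G(\boldsymbol U^{S}_{j,k})$ one uses for $v_x$ the minmod slope $(v_x)_{j,k}$. **One-sided speeds.** $$s^+_{j+1/2,k}=\max\{\max(u^E_{j,k},u^{Roe})+c^E_{j,k}+\beta,\ \max(u^W_{j+1,k},u^{Roe})+c^W_{j+1,k}+\beta,\ 0\},$$ $$s^-_{j+1/2,k}=\min\{\min(u^E_{j,k},u^{Roe})-c^E_{j,k}-\beta,\ \min(u^W_{j+1,k},u^{Roe})-c^W_{j+1,k}-\beta,\ 0\},$$ where $$u^{Roe}=\frac{u^E_{j,k}\sqrt{\rho^E_{j,k}}+u^W_{j+1,k}\sqrt{\rho^W_{j+1,k}}}{\sqrt{\rho^E_{j,k}}+\sqrt{\rho^W_{j+1,k}}},\qquad\beta=\frac{|\boldsymbol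 b^E_{j,k}-\boldsymbol b^W_{j+1,k}|}{\sqrt{\rho^E_{j,k}}+\sqrt{\rho^W_{j+1,k}}},$$ and, at each $E$ or $W$ state, $c\ge0$ with $c^2=\frac1{2\rho}\big[\gamma p+|\boldsymbol b|^2+\sqrt{(\gamma p+|\boldsymbol b|^2)^2-4\gamma p\,b_1^2}\,\big]$. The speeds $s^\pm_{j,k+1/2}$ are defined in the same way with $u$, $E$ at $(j,k)$, $W$ at $(j+1,k)$, $b_1$ (in $c$) replaced by $v$, $N$ at $(j,k)$, $S$ at $(j,k+1)$, $b_2$. **Numerical fluxes.** $$\boldsymbol{\mathcal F}_{j+1/2,k}=\frac{s^+\boldsymbol F(\boldsymbol U^E_{j,k})-s^-\boldsymbol F(\boldsymbol U^W_{j+1,k})}{s^+-s^-}+\frac{s^+s^-}{s^+-s^-}\big(\boldsymbol U^W_{j+1,k}-\boldsymbol U^E_{j,k}\big),\quad s^\pm=s^\pm_{j+1/2,k},$$ $$\boldsymbol{\mathcal G}_{j,k+1/2}=\frac{s^+\boldsymbol G(\boldsymbol U^N_{j,k})-s^-\boldsymbol G(\boldsymbol U^S_{j,k+1})}{s^+-s^-}+\frac{s^+s^-}{s^+-s^-}\big(\boldsymbol U^S_{j,k+1}-\boldsymbol U^N_{j,k}\big),\quad s^\pm=s^\pm_{j,k+1/2}.$$ **Nonconservative terms.** Viewing $\boldsymbol q$ as a function of $\boldsymbol W$, $$\boldsymbol Q_{j,k}=((b_1)_x)_{j,k}\int_{x_{j-1/2}}^{x_{j+1/2}}\boldsymbol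 q(\widetilde{\boldsymbol W}(x,y_k))\,dx,\qquad\boldsymbol R_{j,k}=((b_2)_y)_{j,k}\int_{y_{k-1/2}}^{y_{k+1/2}}\boldsymbol q(\widetilde{\boldsymbol W}(x_j,y))\,dy,$$ $$\boldsymbol Q_{\boldsymbol\Psi,j+1/2,k}=\big((b_1)^W_{j+1,k}-(b_1)^E_{j,k}\big)\int_0^1\boldsymbol q\big(\boldsymbol W^E_{j,k}+s(\boldsymbol W^W_{j+1,k}-\boldsymbol W^E_{j,k})\big)\,ds,$$ $$\boldsymbol R_{\boldsymbol\Psi,j,k+1/2}=\big((b_2)^S_{j,k+1}-(b_2)^N_{j,k}\big)\int_0^1\boldsymbol q\big(\boldsymbol W^N_{j,k}+s(\boldsymbol W^S_{j,k+1}-\boldsymbol W^N_{j,k})\big)\,ds.$$ **The scheme.** $$\frac{d}{dt}\overline{\boldsymbol U}_{j,k}=-\frac1{\Delta x}\Big[\boldsymbol{\mathcal F}_{j+1/2,k}-\boldsymbol{\mathcal F}_{j-1/2,k}-\boldsymbol Q_{j,k}-\frac{s^+_{j-1/2,k}}{s^+_{j-1/2,k}-s^-_{j-1/2,k}}\boldsymbol Q_{\boldsymbol\Psi,j-1/2,k}+\frac{s^-_{j+1/2,k}}{s^+_{j+1/2,k}-s^-_{j+1/2,k}}\boldsymbol Q_{\boldsymbol\Psi,j+1/2,k}\Big]$$ $$-\frac1{\Delta y}\Big[\boldsymbol{\mathcal G}_{j,k+1/2}-\boldsymbol{\mathcal G}_{j,k-1/2}-\boldsymbol R_{j,k}-\frac{s^+_{j,k-1/2}}{s^+_{j,k-1/2}-s^-_{j,k-1/2}}\boldsymbol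 R_{\boldsymbol\Psi,j,k-1/2}+\frac{s^-_{j,k+1/2}}{s^+_{j,k+1/2}-s^-_{j,k+1/2}}\boldsymbol R_{\boldsymbol\Psi,j,k+1/2}\Big].$$ A solution on $[0,T]$ is a continuously differentiable family $\overline{\boldsymbol U}_{j,k}(t)$ satisfying these ODEs for all cells, with all cell values and reconstructed interface values of $\rho$ and $p$ positive (so that every quantity above is well defined). *)

(* Defs.v *)
From Stdlib Require Import Reals ZArith.
From Coquelicot Require Import Coquelicot.
Open Scope R_scope.

(* Components of U, in order:
   (rho, rho u, rho v, rho w, b1, b2, b3, E, A, B). *)
Inductive cvar : Set :=
  cRho | cMu | cMv | cMw | cB1 | cB2 | cB3 | cE | cA | cB.

(* Components of W, in order: (rho, u, v, w, b1, b2, b3, p, A, B). *)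
Inductive pvar : Set :=
  pRho | pU | pV | pW | pB1 | pB2 | pB3 | pP | pA | pB.

Definition cons := cvar -> R.
Definition prim := pvar -> R.

Definition b_sq (W : prim) : R := W pB1 ^ 2 + W pB2 ^ 2 + W pB3 ^ 2.

Definition u_sq (W : prim) : R := W pU ^ 2 + W pV ^ 2 + W pW ^ 2.

Definition u_dot_b (W : prim) : R :=
  W pU * W pB1 + W pV * W pB2 + W pW * W pB3.

(* Solving E = p / (gamma - 1) + rho |u|^2 / 2 + |b|^2 / 2 for p. *)
Definition pressure (gamma : R) (U : cons) : R :=
  (gamma - 1) *
  (U cE
   - U cRho / 2 *
     ((U cMu / U cRho) ^ 2 + (U cMv / U cRho) ^ 2 + (U cMw / U cRho) ^ 2)
   - / 2 * (U cB1 ^ 2 + U cB2 ^ 2 + U cB3 ^ 2)).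

Definition prim_of_cons (gamma : R) (U : cons) : prim := fun i =>
  match i with
  | pRho => U cRho
  | pU => U cMu / U cRho
  | pV => U cMv / U cRho
  | pW => U cMw / U cRho
  | pB1 => U cB1
  | pB2 => U cB2
  | pB3 => U cB3
  | pP => pressure gamma U
  | pA => U cA
  | pB => U cB
  end.

Definition cons_of_prim (gamma : R) (W : prim) : cons := fun i =>
  match i with
  | cRho => W pRho
  | cMu => W pRho * W pU
  | cMv => W pRho * W pV
  | cMw => W pRho * W pW
  | cB1 => W pB1
  | cB2 => W pB2
  | cB3 => W pB3
  | cE => W pP / (gamma - 1) + W pRho / 2 * u_sq W + / 2 * b_sq W
  | cA => W pA
  | cB => W pB
  end.

(* The flux F(U); the derivative u_y in its last two components is the
   argument [uy]. *)
Definition flux_x (gamma : R) (U : cons) (uy : R) : cons :=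
  let W := prim_of_cons gamma U in
  let rho := W pRho in
  let u := W pU in let v := W pV in let w := W pW in
  let b1 := W pB1 in let b2 := W pB2 in let b3 := W pB3 in
  let ptot := W pP + / 2 * b_sq W in
  fun i =>
  match i with
  | cRho => rho * u
  | cMu => rho * u ^ 2 + ptot - b1 ^ 2
  | cMv => rho * u * v - b1 * b2
  | cMw => rho * u * w - b1 * b3
  | cB1 => 0
  | cB2 => u * b2 - v * b1
  | cB3 => u * b3 - w * b1
  | cE => (U cE + ptot) * u - u_dot_b W * b1
  | cA => u * W pA - b2 * uy
  | cB => u * W pB + b2 * uy
  end.

(* The flux G(U); the derivative v_x in its last two components is the
   argument [vx]. *)
Definition flux_y (gamma : R) (U : cons) (vx : R) : cons :=
  let W := prim_of_cons gamma U in
  let rho := W pRho in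
  let u := W pU in let v := W pV in let w := W pW in
  let b1 := W pB1 in let b2 := W pB2 in let b3 := W pB3 in
  let ptot := W pP + / 2 * b_sq W in
  fun i =>
  match i with
  | cRho => rho * v
  | cMu => rho * u * v - b1 * b2
  | cMv => rho * v ^ 2 + ptot - b2 ^ 2
  | cMw => rho * v * w - b2 * b3
  | cB1 => v * b1 - u * b2
  | cB2 => 0
  | cB3 => v * b3 - w * b2
  | cE => (U cE + ptot) * v - u_dot_b W * b2
  | cA => v * W pA + b1 * vx
  | cB => v * W pB - b1 * vx
  end.

(* The vector q of the Godunov-Powell source term, as a function of W. *)
Definition qvec (W : prim) : cons := fun i =>
  match i with
  | cRho => 0
  | cMu => - W pB1
  | cMv => - W pB2
  | cMw => - W pB3
  | cB1 => - W pU
  | cB2 => - W pV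
  | cB3 => - W pW
  | cE => - u_dot_b W
  | cA => 0
  | cB => 0
  end.

Inductive boundary : Set := Periodic | Free.

(* The mesh consists of the cells (j, k) with 0 <= j < nx and 0 <= k < ny;
   (xmin, ymin) is the lower left corner of the rectangle it covers. *)
Record setup : Set := Setup {
  gamma : R;
  theta : R;
  dx : R;
  dy : R;
  xmin : R;
  ymin : R;
  nx : Z;
  ny : Z;
  bcx : boundary;
  bcy : boundary;
  gamma_gt1 : 1 < gamma;
  theta_gt0 : 0 < theta;
  dx_gt0 : 0 < dx;
  dy_gt0 : 0 < dy;
  nx_gt0 : (0 < nx)%Z;
  ny_gt0 : (0 < ny)%Z
}.

Definition in_mesh (S : setup) (j k : Z) : Prop :=
  (0 <= j < nx S)%Z /\ (0 <= k < ny S)%Z.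

Definition grid := Z -> Z -> cons.

Definition ghost_index (bc : boundary) (n j : Z) : Z :=
  match bc with
  | Periodic => (j mod n)%Z
  | Free => Z.max 0 (Z.min j (n - 1))
  end.

(* All formulas of the scheme read cell averages through [extend]: values of a
   [grid] outside the mesh are never used, and every reconstructed quantity is
   defined in the ghost cells as well. *)
Definition extend (S : setup) (V : grid) : grid := fun j k =>
  V (ghost_index (bcx S) (nx S) j) (ghost_index (bcy S) (ny S) k).

Definition cell_W (S : setup) (V : grid) (j k : Z) : prim :=
  prim_of_cons (gamma S) (extend S V j k).

Definition minmod (a1 a2 a3 : R) : R :=
  let m := sign a1 * Rmin (Rabs a1) (Rmin (Rabs a2) (Rabs a3)) in
  if Rlt_dec 0 a1 then
    if Rlt_dec 0 a2 then if Rlt_dec 0 a3 then m else 0 else 0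
  else if Rlt_dec a1 0 then
    if Rlt_dec a2 0 then if Rlt_dec a3 0 then m else 0 else 0
  else 0.

Definition minmod_x (S : setup) (V : grid) (i : pvar) (j k : Z) : R :=
  let w j' := cell_W S V j' k i in
  minmod (theta S * ((w j - w (j - 1)%Z) / dx S))
         ((w (j + 1)%Z - w (j - 1)%Z) / (2 * dx S))
         (theta S * ((w (j + 1)%Z - w j) / dx S)).

Definition minmod_y (S : setup) (V : grid) (i : pvar) (j k : Z) : R :=
  let w k' := cell_W S V j k' i in
  minmod (theta S * ((w k - w (k - 1)%Z) / dy S))
         ((w (k + 1)%Z - w (k - 1)%Z) / (2 * dy S))
         (theta S * ((w (k + 1)%Z - w k) / dy S)).

(* sigma^x and sigma^y, where [h] is the minmod slope and [a] the cell average
   of A, respectively B. *)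
Definition limiter (h a : R) : R :=
  if Rlt_dec 0 (h * a) then Rmin 1 (h / a) else 0.

Definition sigma (S : setup) (V : grid) (j k : Z) : R :=
  Rmin 1
    (Rmin (limiter (minmod_x S V pB1 j k) (cell_W S V j k pA))
          (limiter (minmod_y S V pB2 j k) (cell_W S V j k pB))).

Definition slope_x (S : setup) (V : grid) (i : pvar) (j k : Z) : R :=
  match i with
  | pB1 => sigma S V j k * cell_W S V j k pA
  | _ => minmod_x S V i j k
  end.

Definition slope_y (S : setup) (V : grid) (i : pvar) (j k : Z) : R :=
  match i with
  | pB2 => sigma S V j k * cell_W S V j k pB
  | _ => minmod_y S V i j k
  end.

Definition W_E (S : setup) (V : grid) (j k : Z) : prim := fun i =>
  cell_W S V j k i + dx S / 2 * slope_x S V i j k.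
Definition W_W (S : setup) (V : grid) (j k : Z) : prim := fun i =>
  cell_W S V j k i - dx S / 2 * slope_x S V i j k.
Definition W_N (S : setup) (V : grid) (j k : Z) : prim := fun i =>
  cell_W S V j k i + dy S / 2 * slope_y S V i j k.
Definition W_S (S : setup) (V : grid) (j k : Z) : prim := fun i =>
  cell_W S V j k i - dy S / 2 * slope_y S V i j k.

Definition U_E (S : setup) (V : grid) (j k : Z) : cons :=
  cons_of_prim (gamma S) (W_E S V j k).
Definition U_W (S : setup) (V : grid) (j k : Z) : cons :=
  cons_of_prim (gamma S) (W_W S V j k).
Definition U_N (S : setup) (V : grid) (j k : Z) : cons :=
  cons_of_prim (gamma S) (W_N S V j k).
Definition U_S (S : setup) (V : grid) (j k : Z) : cons :=
  cons_of_prim (gamma S) (W_S S V j k).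

(* In the next five definitions [un] and [bn] select the velocity and magnetic
   field components normal to the interface (u, b1 or v, b2), and [WL], [WR]
   are the two states at the interface: (E, W) or (N, S). *)

Definition sound (gam : R) (bn : pvar) (W : prim) : R :=
  let g := gam * W pP + b_sq W in
  sqrt (/ (2 * W pRho) *
        (g + sqrt (g ^ 2 - 4 * (gam * W pP) * W bn ^ 2))).

Definition roe (un : pvar) (WL WR : prim) : R :=
  (WL un * sqrt (WL pRho) + WR un * sqrt (WR pRho))
  / (sqrt (WL pRho) + sqrt (WR pRho)).

Definition beta (WL WR : prim) : R :=
  sqrt ((WL pB1 - WR pB1) ^ 2 + (WL pB2 - WR pB2) ^ 2 + (WL pB3 - WR pB3) ^ 2)
  / (sqrt (WL pRho) + sqrt (WR pRho)).

Definition speed_plus (gam : R) (un bn : pvar) (WL WR : prim) : R :=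
  let r := roe un WL WR in
  Rmax (Rmax (WL un) r + sound gam bn WL + beta WL WR)
       (Rmax (Rmax (WR un) r + sound gam bn WR + beta WL WR) 0).

Definition speed_minus (gam : R) (un bn : pvar) (WL WR : prim) : R :=
  let r := roe un WL WR in
  Rmin (Rmin (WL un) r - sound gam bn WL - beta WL WR)
       (Rmin (Rmin (WR un) r - sound gam bn WR - beta WL WR) 0).

(* Half-integer indices are rounded down: the interface quantities below, at
   (j, k), refer to (j+1/2, k) in the x-direction and to (j, k+1/2) in the
   y-direction. *)

Definition sxp (S : setup) (V : grid) (j k : Z) : R :=
  speed_plus (gamma S) pU pB1 (W_E S V j k) (W_W S V (j + 1)%Z k).
Definition sxm (S : setup) (V : grid) (j k : Z) : R :=
  speed_minus (gamma S) pU pB1 (W_E S V j k) (W_W S V (j + 1)%Z k).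
Definition syp (S : setup) (V : grid) (j k : Z) : R :=
  speed_plus (gamma S) pV pB2 (W_N S V j k) (W_S S V j (k + 1)%Z).
Definition sym (S : setup) (V : grid) (j k : Z) : R :=
  speed_minus (gamma S) pV pB2 (W_N S V j k) (W_S S V j (k + 1)%Z).

Definition cu_flux (sp sm : R) (FL FR UL UR : cons) : cons := fun i =>
  (sp * FL i - sm * FR i) / (sp - sm)
  + sp * sm / (sp - sm) * (UR i - UL i).

Definition num_flux_x (S : setup) (V : grid) (j k : Z) : cons :=
  cu_flux (sxp S V j k) (sxm S V j k)
    (flux_x (gamma S) (U_E S V j k) (slope_y S V pU j k))
    (flux_x (gamma S) (U_W S V (j + 1)%Z k) (slope_y S V pU (j + 1)%Z k))
    (U_E S V j k) (U_W S V (j + 1)%Z k).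

Definition num_flux_y (S : setup) (V : grid) (j k : Z) : cons :=
  cu_flux (syp S V j k) (sym S V j k)
    (flux_y (gamma S) (U_N S V j k) (slope_x S V pV j k))
    (flux_y (gamma S) (U_S S V j (k + 1)%Z) (slope_x S V pV j (k + 1)%Z))
    (U_N S V j k) (U_S S V j (k + 1)%Z).

Definition x_left (S : setup) (j : Z) : R := xmin S + IZR j * dx S.
Definition y_low (S : setup) (k : Z) : R := ymin S + IZR k * dy S.
Definition x_center (S : setup) (j : Z) : R := x_left S j + dx S / 2.
Definition y_center (S : setup) (k : Z) : R := y_low S k + dy S / 2.

(* The linear piece of the reconstruction on the cell (j, k). *)
Definition W_rec (S : setup) (V : grid) (j k : Z) (x y : R) : prim := fun i =>
  cell_W S V j k i
  + slope_x S V i j k * (x - x_center S j)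
  + slope_y S V i j k * (y - y_center S k).

Definition Q_cell (S : setup) (V : grid) (j k : Z) : cons := fun i =>
  slope_x S V pB1 j k *
  RInt (fun x => qvec (W_rec S V j k x (y_center S k)) i)
       (x_left S j) (x_left S (j + 1)%Z).

Definition R_cell (S : setup) (V : grid) (j k : Z) : cons := fun i =>
  slope_y S V pB2 j k *
  RInt (fun y => qvec (W_rec S V j k (x_center S j) y) i)
       (y_low S k) (y_low S (k + 1)%Z).

(* Integral of q along the segment path from WL to WR. *)
Definition path_integral (WL WR : prim) : cons := fun i =>
  RInt (fun s => qvec (fun l => WL l + s * (WR l - WL l)) i) 0 1.

Definition Q_psi (S : setup) (V : grid) (j k : Z) : cons := fun i =>
  (W_W S V (j + 1)%Z k pB1 - W_E S V j k pB1) *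
  path_integral (W_E S V j k) (W_W S V (j + 1)%Z k) i.

Definition R_psi (S : setup) (V : grid) (j k : Z) : cons := fun i =>
  (W_S S V j (k + 1)%Z pB2 - W_N S V j k pB2) *
  path_integral (W_N S V j k) (W_S S V j (k + 1)%Z) i.

Definition scheme_rhs (S : setup) (V : grid) (j k : Z) : cons := fun i =>
  let jm := (j - 1)%Z in
  let km := (k - 1)%Z in
  - / dx S *
    (num_flux_x S V j k i - num_flux_x S V jm k i - Q_cell S V j k i
     - sxp S V jm k / (sxp S V jm k - sxm S V jm k) * Q_psi S V jm k i
     + sxm S V j k / (sxp S V j k - sxm S V j k) * Q_psi S V j k i)
  - / dy S *
    (num_flux_y S V j k i - num_flux_y S V j km i - R_cell S V j k i
     - syp S V j km / (syp S V j km - sym S V j km) * R_psi S V j km i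
     + sym S V j k / (syp S V j k - sym S V j k) * R_psi S V j k i).

Definition positive_state (W : prim) : Prop := 0 < W pRho /\ 0 < W pP.

Definition admissible (S : setup) (V : grid) : Prop :=
  forall j k, in_mesh S j k ->
    positive_state (cell_W S V j k) /\
    positive_state (W_E S V j k) /\ positive_state (W_W S V j k) /\
    positive_state (W_N S V j k) /\ positive_state (W_S S V j k).

(* f is continuously differentiable on [0, T] with derivative f', one-sided at
   the end points. *)
Definition C1_on (T : R) (f f' : R -> R) : Prop :=
  let I := fun t : R => 0 <= t <= T in
  (forall t, I t ->
     filterdiff f (within I (locally t)) (fun h : R => scal h (f' t))) /\
  continuous_on I f'.

Definition is_solution (S : setup) (T : R) (U : R -> grid) : Prop :=
  (forall t, 0 <= t <= T -> admissible S (U t)) /\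
  (forall j k i, in_mesh S j k ->
     C1_on T (fun t => U t j k i) (fun t => scheme_rhs S (U t) j k i)).

(* Main.v *)
Require Import Defs.
From Stdlib Require Import Reals ZArith Lra Lia.
From Coquelicot Require Import Coquelicot.
Open Scope R_scope.

(** Let D = A + B be the discrete divergence of a cell. In the evolution of D
    the sources drop out, since the last two components of q vanish, and so do
    the terms in u_y and v_x of the fluxes: D is transported by the velocity.
    What remains is a central-upwind scheme for D, except that A and B are
    reconstructed separately and minmod is not additive. Minmod is however odd
    and Lipschitz, so the slopes of A and B cancel up to a multiple of the
    largest |D| in the neighbouring cells ([minmod_nearly_opposite]). Hence an
    interface value of D is at most a constant, depending on theta only, times
    the largest |D| on the mesh ([interface_nearly_opposite]).

    On the compact interval [0, T] the velocities and the one-sided speeds at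
    the interfaces are bounded, because the cell averages are continuous in time
    and the reconstructed densities are continuous and positive, hence bounded
    away from zero. The upwind weights lie in [0, 1]. Therefore
    |dD/dt| <= K max |D| in every cell ([scheme_rhs_bound]), and Gronwall's lemma
    ([gronwall_family]) propagates D = 0 from the initial time.

    The two slopes of the theorem are A and B multiplied by the same factor
    sigma, so their sum is sigma D = 0. This is where it matters that one sigma
    limits both slopes. *)

(** * Functions on a compact time interval *)

(** The one-sided notions used in [C1_on] become two-sided ones after
    composition with this retraction of the line onto [0, T]; this is how the
    mean value and extreme value theorems are applied below. *)
Definition clamp (T t : R) : R := Rmax 0 (Rmin T t).

Lemma clamp_in (T t : R) : 0 <= T -> 0 <= clamp T t <= T.
Proof.
  intros hT; unfold clamp; split; [apply Rmax_l|].
  apply Rmax_lub; [exact hT | apply Rmin_l].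
Qed.

Lemma clamp_id (T t : R) : 0 <= t <= T -> clamp T t = t.
Proof.
  intros ht; unfold clamp; rewrite Rmin_right, Rmax_right; lra.
Qed.

Lemma continuous_Rmax_comp (f g : R -> R) (t : R) :
  continuous f t -> continuous g t -> continuous (fun s => Rmax (f s) (g s)) t.
Proof.
  intros hf hg.
  apply continuous_ext with (f := fun s => / 2 * ((f s + g s) + Rabs (f s - g s))).
  - intros s; apply Rmax_case_strong; intros h;
      unfold Rabs; destruct (Rcase_abs (f s - g s)); simpl; lra.
  - apply (continuous_mult (fun _ => / 2)); [apply continuous_const|].
    apply (continuous_plus (fun s => f s + g s)).
    + apply (continuous_plus f g); assumption.
    + apply continuous_Rabs_comp, (continuous_minus f g); assumption.
Qed.

Lemma continuous_Rmin_comp (f g : R -> R) (t : R) :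
  continuous f t -> continuous g t -> continuous (fun s => Rmin (f s) (g s)) t.
Proof.
  intros hf hg.
  apply continuous_ext with (f := fun s => - Rmax (- f s) (- g s)).
  - intros s; rewrite Ropp_Rmax, !Ropp_involutive; reflexivity.
  - apply (continuous_opp (fun s => Rmax (- f s) (- g s))).
    apply continuous_Rmax_comp; [apply (continuous_opp f) | apply (continuous_opp g)];
      assumption.
Qed.

Lemma continuous_clamp (T t : R) : continuous (clamp T) t.
Proof.
  apply (continuous_Rmax_comp (fun _ => 0) (fun s => Rmin T s));
    [apply continuous_const|].
  apply continuous_Rmin_comp; [apply continuous_const | apply continuous_id].
Qed.

Lemma C1_on_continuous (T : R) (f f' : R -> R) (t : R) :
  0 <= T -> C1_on T f f' -> continuous (fun s => f (clamp T s)) t.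
Proof.
  intros hT [hd _].
  pose proof (clamp_in T t hT) as hc.
  unfold continuous.
  apply filterlim_comp with
    (G := within (fun s => 0 <= s <= T) (locally (clamp T t))).
  - intros P hP.
    generalize (continuous_clamp T t _ hP); unfold filtermap.
    apply filter_imp; intros s hs; apply hs, clamp_in, hT.
  - apply (@filterdiff_continuous_aux R_AbsRing R_NormedModule R_NormedModule
             (within (fun s => 0 <= s <= T) (locally (clamp T t)))
             (within_filter _ _ _ _) f).
    + eexists; apply (hd _ hc).
    + intros P hP; unfold within.
      revert hP; apply filter_imp; auto.
Qed.

Lemma C1_on_is_derive (T : R) (f f' : R -> R) (t : R) :
  C1_on T f f' -> 0 < t < T -> is_derive (fun s => f (clamp T s)) t (f' t).
Proof.
  intros [hd _] ht.
  assert (hn : locally t (fun s => 0 <= s <= T)).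
  { assert (he : 0 < Rmin t (T - t)) by (apply Rmin_pos; lra).
    exists (mkposreal _ he); intros s hs.
    change (Rabs (s - t) < Rmin t (T - t)) in hs.
    apply Rabs_def2 in hs.
    pose proof (Rmin_l t (T - t)); pose proof (Rmin_r t (T - t)); lra. }
  apply is_derive_ext_loc with (f := f).
  - revert hn; apply filter_imp; intros s hs; rewrite clamp_id; auto.
  - assert (h : 0 <= t <= T) by lra.
    destruct (hd t h) as [hl hv]; split; [exact hl|].
    intros x hx.
    assert (hx' : is_filter_lim (within (fun s => 0 <= s <= T) (locally t)) x).
    { intros P hP; generalize (hx P hP); unfold within.
      apply filter_imp; auto. }
    intros eps; specialize (hv x hx' eps); unfold within in hv.
    generalize (filter_and _ _ hv hn); apply filter_imp.
    intros s [h1 h2]; auto.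
Qed.

Lemma C1_on_plus (T : R) (f f' g g' : R -> R) :
  C1_on T f f' -> C1_on T g g' ->
  C1_on T (fun t => f t + g t) (fun t => f' t + g' t).
Proof.
  intros [hf cf] [hg cg]; split.
  - intros t ht.
    eapply filterdiff_ext_lin.
    + apply (filterdiff_plus_fct (F := within (fun t => 0 <= t <= T) (locally t)) f g);
        [apply hf | apply hg]; exact ht.
    + intros h; unfold plus, scal; simpl; unfold mult; simpl; ring.
  - intros t ht.
    apply (filterlim_comp_2 f' g' Rplus (cf t ht) (cg t ht)).
    apply (filterlim_plus (f' t) (g' t)).
Qed.

(** The mean value inequality with a variable bound on the derivative: both
    [g + f] and [g - f] are nondecreasing. *)
Lemma C1_on_growth (T : R) (f f' g g' : R -> R) :
  C1_on T f f' -> (forall t, is_derive g t (g' t)) ->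
  (forall t, 0 <= t <= T -> Rabs (f' t) <= g' t) ->
  forall t, 0 <= t <= T -> Rabs (f t - f 0) <= g t - g 0.
Proof.
  intros hf hg hb t ht.
  assert (main : forall s, Rabs s = 1 -> 0 <= (g t - g 0) + s * (f t - f 0)).
  { intros s hs.
    destruct (MVT_gen (fun x => g x + s * f (clamp T x)) 0 t
                (fun x => g' x + s * f' x)) as [c [hc he]].
    - intros x; rewrite Rmin_left, Rmax_right by lra; intros hx.
      apply (is_derive_plus g); [apply hg|].
      apply (is_derive_scal (fun x => f (clamp T x))), C1_on_is_derive; [exact hf|lra].
    - intros x hx; apply continuity_pt_filterlim.
      apply (continuous_plus g (fun x => s * f (clamp T x))).
      + apply (ex_derive_continuous g); eexists; apply hg.
      + apply (continuous_mult (fun _ => s)); [apply continuous_const|].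
        apply C1_on_continuous with (f' := f'); [lra | exact hf].
    - rewrite Rmin_left, Rmax_right in hc by lra.
      rewrite !clamp_id in he by lra.
      assert (hc' : 0 <= c <= T) by lra.
      assert (h1 : Rabs (s * f' c) <= g' c).
      { rewrite Rabs_mult, hs, Rmult_1_l; apply hb, hc'. }
      apply Rabs_le_between in h1.
      assert (0 <= (g' c + s * f' c) * (t - 0)) by (apply Rmult_le_pos; lra).
      lra. }
  apply Rabs_le_between.
  pose proof (main 1 Rabs_R1) as h1.
  assert (hm : Rabs (-1) = 1) by (rewrite Rabs_left; lra).
  pose proof (main (-1) hm); lra.
Qed.

(** Gronwall's lemma for a family, in the sup norm. In the norm
    [sup |f i t| exp (- 2 K t)] integration of the hypothesis gains a factor
    1/2, so the norm vanishes. *)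
Lemma gronwall_family (I : Type) (P : I -> Prop) (T K M0 : R)
  (f f' : I -> R -> R) :
  0 < K ->
  (forall i, P i -> C1_on T (f i) (f' i)) ->
  (forall i, P i -> f i 0 = 0) ->
  (forall i t, P i -> 0 <= t <= T -> Rabs (f i t) <= M0) ->
  (forall t M, 0 <= t <= T -> (forall i, P i -> Rabs (f i t) <= M) ->
     forall i, P i -> Rabs (f' i t) <= K * M) ->
  forall i t, P i -> 0 <= t <= T -> f i t = 0.
Proof.
  intros hK hC h0 hM hL i t hi ht.
  assert (M0_ge0 : 0 <= M0).
  { eapply Rle_trans; [apply Rabs_pos | apply (hM i t hi ht)]. }
  (* [n] rounds of the contraction of the weighted norm *)
  assert (iter : forall n j s, P j -> 0 <= s <= T ->
            Rabs (f j s) <= M0 * (/ 2) ^ n * exp (2 * K * s)).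
  { induction n as [|n IH]; intros j s hj hs.
    - apply Rle_trans with (1 := hM j s hj hs).
      assert (1 <= exp (2 * K * s)).
      { rewrite <- exp_0.
        assert (0 <= 2 * K * s) by (apply Rmult_le_pos; lra).
        destruct (Req_dec (2 * K * s) 0) as [->|]; [lra|].
        left; apply exp_increasing; lra. }
      simpl; nra.
    - set (C := M0 * (/ 2) ^ n) in *.
      assert (0 <= C) by (apply Rmult_le_pos; [lra | apply pow_le; lra]).
      pose proof (C1_on_growth T (f j) (f' j)
                    (fun x => C / 2 * exp (2 * K * x))
                    (fun x => K * (C * exp (2 * K * x)))) as G.
      specialize (G (hC j hj)).
      assert (hg : Rabs (f j s - f j 0)
                   <= C / 2 * exp (2 * K * s) - C / 2 * exp (2 * K * 0)).
      { apply G; [| |exact hs].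
        - intros x; auto_derive; [exact Logic.I|]; field.
        - intros x hx; apply hL; [exact hx | | exact hj].
          intros l hl; apply IH; assumption. }
      rewrite (h0 j hj), Rminus_0_r in hg.
      pose proof (exp_pos (2 * K * 0)).
      assert (0 <= C / 2 * exp (2 * K * 0)) by (apply Rmult_le_pos; lra).
      replace (M0 * (/ 2) ^ S n) with (C / 2) by (unfold C; simpl; field).
      lra. }
  assert (hle : Rbar_le (Rabs (f i t)) 0).
  { apply is_lim_seq_le with (u := fun _ => Rabs (f i t))
      (v := fun n => (M0 * exp (2 * K * t)) * (/ 2) ^ n).
    - intros n; rewrite <- (Rmult_comm ((/ 2) ^ n)), <- Rmult_assoc.
      rewrite (Rmult_comm _ M0); apply iter; assumption.
    - apply is_lim_seq_const.
    - replace (Finite 0) with (Rbar_mult (M0 * exp (2 * K * t)) 0)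
        by (simpl; f_equal; ring).
      apply is_lim_seq_scal_l, is_lim_seq_geom.
      rewrite Rabs_pos_eq; lra. }
  simpl in hle.
  apply Rabs_eq_0, Rle_antisym; [exact hle | apply Rabs_pos].
Qed.

(** * Bounded functions of time *)

Definition bounded_on (T : R) (f : R -> R) : Prop :=
  exists M, forall t, 0 <= t <= T -> Rabs (f t) <= M.

Lemma bounded_dom (T : R) (f g : R -> R) :
  (forall t, 0 <= t <= T -> Rabs (f t) <= Rabs (g t)) ->
  bounded_on T g -> bounded_on T f.
Proof.
  intros h [M hM]; exists M; intros t ht.
  apply Rle_trans with (1 := h t ht); auto.
Qed.

Lemma bounded_const (T c : R) : bounded_on T (fun _ => c).
Proof. exists (Rabs c); intros; lra. Qed.

Lemma bounded_plus (T : R) (f g : R -> R) :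
  bounded_on T f -> bounded_on T g -> bounded_on T (fun t => f t + g t).
Proof.
  intros [M hM] [N hN]; exists (M + N); intros t ht.
  specialize (hM t ht); specialize (hN t ht).
  pose proof (Rabs_triang (f t) (g t)); lra.
Qed.

Lemma bounded_opp (T : R) (f : R -> R) :
  bounded_on T f -> bounded_on T (fun t => - f t).
Proof.
  apply bounded_dom; intros; rewrite Rabs_Ropp; lra.
Qed.

Lemma bounded_minus (T : R) (f g : R -> R) :
  bounded_on T f -> bounded_on T g -> bounded_on T (fun t => f t - g t).
Proof.
  intros hf hg; apply (bounded_plus T f); [|apply bounded_opp]; assumption.
Qed.

Lemma bounded_mult (T : R) (f g : R -> R) :
  bounded_on T f -> bounded_on T g -> bounded_on T (fun t => f t * g t).
Proof.
  intros [M hM] [N hN]; exists (M * N); intros t ht.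
  rewrite Rabs_mult.
  apply Rmult_le_compat; auto using Rabs_pos.
Qed.

Lemma bounded_pow (T : R) (f : R -> R) (n : nat) :
  bounded_on T f -> bounded_on T (fun t => f t ^ n).
Proof.
  intros hf; induction n as [|n IH]; simpl;
    [apply bounded_const | apply bounded_mult; assumption].
Qed.

Lemma bounded_max (T : R) (f g : R -> R) :
  bounded_on T f -> bounded_on T g -> bounded_on T (fun t => Rmax (f t) (g t)).
Proof.
  intros [M hM] [N hN]; exists (M + N); intros t ht.
  specialize (hM t ht); specialize (hN t ht).
  pose proof (Rabs_pos (f t)); pose proof (Rabs_pos (g t)).
  apply Rmax_case; lra.
Qed.

Lemma bounded_min (T : R) (f g : R -> R) :
  bounded_on T f -> bounded_on T g -> bounded_on T (fun t => Rmin (f t) (g t)).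
Proof.
  intros [M hM] [N hN]; exists (M + N); intros t ht.
  specialize (hM t ht); specialize (hN t ht).
  pose proof (Rabs_pos (f t)); pose proof (Rabs_pos (g t)).
  apply Rmin_case; lra.
Qed.

Lemma bounded_sqrt (T : R) (f : R -> R) :
  bounded_on T f -> bounded_on T (fun t => sqrt (f t)).
Proof.
  intros [M hM]; exists (sqrt M); intros t ht.
  rewrite Rabs_pos_eq by apply sqrt_pos.
  apply sqrt_le_1_alt.
  apply Rle_trans with (2 := hM t ht), Rle_abs.
Qed.

Lemma bounded_inv_double (T : R) (f : R -> R) :
  bounded_on T (fun t => / f t) -> bounded_on T (fun t => / (2 * f t)).
Proof.
  intros h.
  apply bounded_dom with (g := fun t => / 2 * / f t).
  - intros t _; rewrite Rinv_mult; lra.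
  - apply bounded_mult; [apply bounded_const | exact h].
Qed.

Lemma continuous_bounded_below (T : R) (f : R -> R) :
  0 <= T -> (forall t, continuous (fun s => f (clamp T s)) t) ->
  exists m, 0 <= m <= T /\ forall t, 0 <= t <= T -> f m <= f t.
Proof.
  intros hT hf.
  destruct (continuity_ab_min (fun s => f (clamp T s)) 0 T hT) as [m [h1 h2]].
  - intros c _; apply continuity_pt_filterlim, hf.
  - exists m; split; [exact h2|]; intros t ht.
    specialize (h1 t ht); rewrite !clamp_id in h1; auto.
Qed.

Lemma continuous_bounded (T : R) (f : R -> R) :
  0 <= T -> (forall t, continuous (fun s => f (clamp T s)) t) -> bounded_on T f.
Proof.
  intros hT hf.
  destruct (continuous_bounded_below T (fun t => - Rabs (f t)) hT) as [m [_ hm]].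
  - intros t; apply (continuous_opp (fun s => Rabs (f (clamp T s)))).
    apply continuous_Rabs_comp, hf.
  - exists (Rabs (f m)); intros t ht; specialize (hm t ht); lra.
Qed.

Lemma inverse_bounded (T : R) (f : R -> R) :
  0 <= T -> (forall t, continuous (fun s => f (clamp T s)) t) ->
  (forall t, 0 <= t <= T -> 0 < f t) -> bounded_on T (fun t => / f t).
Proof.
  intros hT hf hp.
  destruct (continuous_bounded_below T f hT hf) as [m [hm hm']].
  exists (/ f m); intros t ht.
  rewrite Rabs_pos_eq.
  - apply Rinv_le_contravar; auto.
  - left; apply Rinv_0_lt_compat; auto.
Qed.

(** * The minmod function *)

(** A formula without case distinctions, from which continuity, oddness and
    Lipschitz dependence on the arguments are read off. *)
Lemma minmod_max_min (a b c : R) :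
  minmod a b c = Rmax 0 (Rmin a (Rmin b c)) + Rmin 0 (Rmax a (Rmax b c)).
Proof.
  unfold minmod, sign, Rmax, Rmin, Rabs.
  destruct (total_order_T 0 a) as [[?|?]|?];
  destruct (Rle_dec b c);
  repeat match goal with
  | |- context [Rcase_abs ?x] => destruct (Rcase_abs x); try lra
  | |- context [Rlt_dec ?x ?y] => destruct (Rlt_dec x y); try lra
  | |- context [Rle_dec ?x ?y] => destruct (Rle_dec x y); try lra
  | H : context [Rle_dec ?x ?y] |- _ => destruct (Rle_dec x y); try lra
  end.
Qed.

Lemma minmod_opp (a b c : R) : minmod (- a) (- b) (- c) = - minmod a b c.
Proof.
  rewrite !minmod_max_min.
  replace (Rmin (- a) (Rmin (- b) (- c))) with (- Rmax a (Rmax b c))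
    by (rewrite !Ropp_Rmax; reflexivity).
  replace (Rmax (- a) (Rmax (- b) (- c))) with (- Rmin a (Rmin b c))
    by (rewrite !Ropp_Rmin; reflexivity).
  rewrite Ropp_plus_distr, (Ropp_Rmax 0), (Ropp_Rmin 0), Ropp_0; ring.
Qed.

Lemma Rabs_Rmax_sub (a b a' b' e : R) :
  Rabs (a - a') <= e -> Rabs (b - b') <= e ->
  Rabs (Rmax a b - Rmax a' b') <= e.
Proof.
  intros h1 h2; apply Rabs_le_between in h1; apply Rabs_le_between in h2.
  apply Rabs_le_between.
  apply (Rmax_case_strong a b); apply (Rmax_case_strong a' b'); lra.
Qed.

Lemma Rabs_Rmin_sub (a b a' b' e : R) :
  Rabs (a - a') <= e -> Rabs (b - b') <= e ->
  Rabs (Rmin a b - Rmin a' b') <= e.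
Proof.
  intros h1 h2; apply Rabs_le_between in h1; apply Rabs_le_between in h2.
  apply Rabs_le_between.
  apply (Rmin_case_strong a b); apply (Rmin_case_strong a' b'); lra.
Qed.

Lemma minmod_lipschitz (a b c a' b' c' e : R) :
  Rabs (a - a') <= e -> Rabs (b - b') <= e -> Rabs (c - c') <= e ->
  Rabs (minmod a b c - minmod a' b' c') <= 2 * e.
Proof.
  intros ha hb hc; rewrite !minmod_max_min.
  assert (he : Rabs (0 - 0) <= e).
  { rewrite Rminus_diag, Rabs_R0; eapply Rle_trans; [apply Rabs_pos | exact ha]. }
  assert (h1 : Rabs (Rmax 0 (Rmin a (Rmin b c)) - Rmax 0 (Rmin a' (Rmin b' c'))) <= e)
    by (apply Rabs_Rmax_sub, Rabs_Rmin_sub, Rabs_Rmin_sub; assumption).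
  assert (h2 : Rabs (Rmin 0 (Rmax a (Rmax b c)) - Rmin 0 (Rmax a' (Rmax b' c'))) <= e)
    by (apply Rabs_Rmin_sub, Rabs_Rmax_sub, Rabs_Rmax_sub; assumption).
  apply Rabs_le_between in h1; apply Rabs_le_between in h2.
  apply Rabs_le_between; lra.
Qed.

(** Minmod is not additive, but being odd and Lipschitz it nearly cancels on
    nearly opposite arguments. *)
Lemma minmod_nearly_opposite (a b c a' b' c' e : R) :
  Rabs (a + a') <= e -> Rabs (b + b') <= e -> Rabs (c + c') <= e ->
  Rabs (minmod a b c + minmod a' b' c') <= 2 * e.
Proof.
  intros ha hb hc.
  rewrite <- (Ropp_involutive (minmod a' b' c')), <- minmod_opp.
  apply minmod_lipschitz; unfold Rminus; rewrite Ropp_involutive; assumption.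
Qed.

Lemma minmod_le_abs (a b c : R) : Rabs (minmod a b c) <= Rabs a.
Proof.
  rewrite minmod_max_min; unfold Rmax, Rmin, Rabs.
  destruct (Rle_dec b c), (Rle_dec a b), (Rle_dec a c);
  repeat match goal with
  | |- context [Rcase_abs ?x] => destruct (Rcase_abs x); try lra
  | |- context [Rle_dec ?x ?y] => destruct (Rle_dec x y); try lra
  | H : context [Rle_dec ?x ?y] |- _ => destruct (Rle_dec x y); try lra
  end.
Qed.

Lemma minmod_zero_l (b c : R) : minmod 0 b c = 0.
Proof.
  pose proof (minmod_le_abs 0 b c) as h; rewrite Rabs_R0 in h.
  apply Rabs_eq_0, Rle_antisym; [exact h | apply Rabs_pos].
Qed.

Lemma minmod_zero_r (a b : R) : minmod a b 0 = 0.
Proof.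
  unfold minmod; destruct (Rlt_dec 0 a), (Rlt_dec 0 b), (Rlt_dec a 0), (Rlt_dec b 0),
    (Rlt_dec 0 0); lra.
Qed.

Lemma continuous_minmod (f g h : R -> R) (t : R) :
  continuous f t -> continuous g t -> continuous h t ->
  continuous (fun s => minmod (f s) (g s) (h s)) t.
Proof.
  intros hf hg hh.
  apply continuous_ext with
    (f := fun s => Rmax 0 (Rmin (f s) (Rmin (g s) (h s)))
                   + Rmin 0 (Rmax (f s) (Rmax (g s) (h s)))).
  - intros s; symmetry; apply minmod_max_min.
  - apply (continuous_plus (fun s => Rmax 0 (Rmin (f s) (Rmin (g s) (h s))))).
    + apply (continuous_Rmax_comp (fun _ => 0)); [apply continuous_const|].
      apply continuous_Rmin_comp; [exact hf | apply continuous_Rmin_comp; assumption].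
    + apply (continuous_Rmin_comp (fun _ => 0)); [apply continuous_const|].
      apply continuous_Rmax_comp; [exact hf | apply continuous_Rmax_comp; assumption].
Qed.

(** * Slopes of a sequence of cell values *)

(** The common one-dimensional form of [minmod_x] and [minmod_y]. *)
Definition minmod_slope (th h : R) (w : Z -> R) (j : Z) : R :=
  minmod (th * ((w j - w (j - 1)%Z) / h))
         ((w (j + 1)%Z - w (j - 1)%Z) / (2 * h))
         (th * ((w (j + 1)%Z - w j) / h)).

Lemma minmod_slope_bounded (T th h : R) (w : R -> Z -> R) (j : Z) :
  (forall l, bounded_on T (fun t => w t l)) ->
  bounded_on T (fun t => minmod_slope th h (w t) j).
Proof.
  intros hw.
  apply bounded_dom with (g := fun t => th * ((w t j - w t (j - 1)%Z) / h)).
  - intros t _; apply minmod_le_abs.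
  - apply bounded_mult; [apply bounded_const|].
    apply bounded_mult; [apply bounded_minus; apply hw | apply bounded_const].
Qed.

Lemma minmod_slope_continuous (th h : R) (w : R -> Z -> R) (j : Z) (t : R) :
  (forall l, continuous (fun s => w s l) t) ->
  continuous (fun s => minmod_slope th h (w s) j) t.
Proof.
  intros hw.
  assert (hd : forall a b c, continuous (fun s => (w s a - w s b) / c) t).
  { intros a b c; apply (continuous_mult (fun s => w s a - w s b) (fun _ => / c));
      [apply (continuous_minus (fun s => w s a)); apply hw | apply continuous_const]. }
  apply continuous_minmod; [| apply hd |];
    apply (continuous_mult (fun _ => th)); auto using continuous_const.
Qed.

(** Across a free boundary the one-sided difference in a ghost cell vanishes,
    which switches the slope off; periodic slopes are periodic. *)
Lemma minmod_slope_ghost (th h : R) (bc : boundary) (n j : Z) (w : Z -> R) :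
  (0 < n)%Z ->
  let wg := fun l => w (ghost_index bc n l) in
  minmod_slope th h wg j = minmod_slope th h wg (ghost_index bc n j)
  \/ minmod_slope th h wg j = 0.
Proof.
  intros hn wg; unfold minmod_slope, wg; destruct bc; simpl.
  - left.
    rewrite Zminus_mod_idemp_l, Zplus_mod_idemp_l, Zmod_mod; reflexivity.
  - destruct (Z.lt_ge_cases j 0) as [h1|h1]; [right|
      destruct (Z.lt_ge_cases j n) as [h2|h2]; [left|right]].
    + replace (Z.max 0 (Z.min (j - 1) (n - 1)))
        with (Z.max 0 (Z.min j (n - 1))) by lia.
      rewrite Rminus_diag; unfold Rdiv; rewrite Rmult_0_l, Rmult_0_r.
      apply minmod_zero_l.
    + replace (Z.max 0 (Z.min j (n - 1))) with j by lia.
      replace (Z.max 0 (Z.min j (n - 1))) with j by lia; reflexivity.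
    + replace (Z.max 0 (Z.min (j + 1) (n - 1)))
        with (Z.max 0 (Z.min j (n - 1))) by lia.
      rewrite Rminus_diag; unfold Rdiv; rewrite Rmult_0_l, Rmult_0_r.
      apply minmod_zero_r.
Qed.

(** The cell size cancels: the slopes add up to at most a multiple of [M / h],
    and they enter multiplied by [c], plus or minus half the cell size. *)
Lemma interface_nearly_opposite (th h c M : R) (w w' : Z -> R) (j : Z) :
  0 < th -> 0 < h -> Rabs c = h / 2 ->
  (forall l, Rabs (w l + w' l) <= M) ->
  Rabs ((w j + c * minmod_slope th h w j) + (w' j + c * minmod_slope th h w' j))
  <= (2 * th + 2) * M.
Proof.
  intros hth hh hc hw.
  assert (hM : 0 <= M) by (eapply Rle_trans; [apply Rabs_pos | apply (hw j)]).
  assert (hq : 0 <= M / h)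
    by (apply Rmult_le_pos; [lra | left; apply Rinv_0_lt_compat; lra]).
  assert (hd : forall a b, Rabs ((w a - w b) / h + (w' a - w' b) / h) <= 2 * (M / h)).
  { intros a b.
    replace ((w a - w b) / h + (w' a - w' b) / h)
      with (((w a + w' a) - (w b + w' b)) * / h) by (unfold Rdiv; ring).
    rewrite Rabs_mult, (Rabs_pos_eq (/ h)) by (left; apply Rinv_0_lt_compat; lra).
    unfold Rdiv; rewrite <- Rmult_assoc.
    apply Rmult_le_compat_r; [left; apply Rinv_0_lt_compat; lra|].
    pose proof (hw a) as h1; pose proof (hw b) as h2.
    apply Rabs_le_between in h1; apply Rabs_le_between in h2.
    apply Rabs_le_between; lra. }
  set (e := (2 * th + 1) * (M / h)).
  assert (hthM : 0 <= th * (M / h)) by (apply Rmult_le_pos; lra).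
  assert (hs : forall a b, Rabs (th * ((w a - w b) / h) + th * ((w' a - w' b) / h)) <= e).
  { intros a b; rewrite <- Rmult_plus_distr_l, Rabs_mult, (Rabs_pos_eq th) by lra.
    pose proof (Rmult_le_compat_l th _ _ (Rlt_le _ _ hth) (hd a b)).
    unfold e; lra. }
  assert (hm : Rabs (minmod_slope th h w j + minmod_slope th h w' j) <= 2 * e).
  { apply minmod_nearly_opposite; [apply hs | | apply hs].
    pose proof (hd (j + 1)%Z (j - 1)%Z) as h1.
    replace ((w (j + 1)%Z - w (j - 1)%Z) / (2 * h) + (w' (j + 1)%Z - w' (j - 1)%Z) / (2 * h))
      with (/ 2 * ((w (j + 1)%Z - w (j - 1)%Z) / h + (w' (j + 1)%Z - w' (j - 1)%Z) / h))
      by (field; lra).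
    rewrite Rabs_mult, (Rabs_pos_eq (/ 2)) by lra.
    unfold e; lra. }
  replace (w j + c * minmod_slope th h w j + (w' j + c * minmod_slope th h w' j))
    with ((w j + w' j) + c * (minmod_slope th h w j + minmod_slope th h w' j)) by ring.
  eapply Rle_trans; [apply Rabs_triang|].
  rewrite Rabs_mult, hc.
  assert (h / 2 * Rabs (minmod_slope th h w j + minmod_slope th h w' j)
          <= (2 * th + 1) * M).
  { apply Rle_trans with (h / 2 * (2 * e)).
    - apply Rmult_le_compat_l; lra.
    - unfold e; right; field; lra. }
  pose proof (hw j); lra.
Qed.

(** * The central-upwind flux of A + B *)

(** The two upwind weights lie in [0, 1], and [sp] alone controls the numerical
    viscosity. When [sp = sm] both speeds vanish, and so does the left-hand
    side by the convention on division by zero. *)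
Lemma central_upwind_bound (sp sm fL fR uL uR : R) :
  0 <= sp -> sm <= 0 ->
  Rabs ((sp * fL - sm * fR) / (sp - sm) + sp * sm / (sp - sm) * (uR - uL))
  <= Rabs fL + Rabs fR + sp * (Rabs uL + Rabs uR).
Proof.
  intros hp hm.
  set (p := sp * / (sp - sm)); set (q := - sm * / (sp - sm)).
  assert (hpq : 0 <= p <= 1 /\ 0 <= q <= 1).
  { destruct (Req_dec (sp - sm) 0) as [h|h].
    - unfold p, q; replace sp with 0 by lra; replace sm with 0 by lra; lra.
    - assert (hi : 0 < / (sp - sm)) by (apply Rinv_0_lt_compat; lra).
      assert (0 <= p) by (apply Rmult_le_pos; lra).
      assert (0 <= q) by (apply Rmult_le_pos; lra).
      assert (p + q = 1) by (unfold p, q; field; exact h).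
      lra. }
  replace ((sp * fL - sm * fR) / (sp - sm) + sp * sm / (sp - sm) * (uR - uL))
    with (p * fL + q * fR + (sp * q) * (uL - uR)) by (unfold p, q, Rdiv; ring).
  assert (hw : forall a x, 0 <= a <= 1 -> Rabs (a * x) <= Rabs x).
  { intros a x ha; rewrite Rabs_mult, (Rabs_pos_eq a) by lra.
    pose proof (Rabs_pos x); nra. }
  assert (hv : Rabs (sp * q * (uL - uR)) <= sp * (Rabs uL + Rabs uR)).
  { rewrite Rmult_assoc, Rabs_mult, (Rabs_pos_eq sp) by lra.
    apply Rmult_le_compat_l; [exact hp|].
    eapply Rle_trans; [apply hw; lra|].
    eapply Rle_trans; [apply Rabs_triang|]; rewrite Rabs_Ropp; lra. }
  eapply Rle_trans; [apply Rabs_triang|].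
  eapply Rle_trans; [apply Rplus_le_compat_r, Rabs_triang|].
  pose proof (hw p fL); pose proof (hw q fR); lra.
Qed.

(** The terms in [u_y] cancel: [A + B] is a scalar transported by the flow. *)
Lemma flux_x_divergence (gam d : R) (W : prim) : W pRho <> 0 ->
  flux_x gam (cons_of_prim gam W) d cA + flux_x gam (cons_of_prim gam W) d cB
  = W pU * (W pA + W pB).
Proof. intros h; unfold flux_x, prim_of_cons, cons_of_prim; field; exact h. Qed.

Lemma flux_y_divergence (gam d : R) (W : prim) : W pRho <> 0 ->
  flux_y gam (cons_of_prim gam W) d cA + flux_y gam (cons_of_prim gam W) d cB
  = W pV * (W pA + W pB).
Proof. intros h; unfold flux_y, prim_of_cons, cons_of_prim; field; exact h. Qed.

(** What the wave speeds at an interface need in order to stay bounded. *)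
Definition regular_state (T : R) (W : R -> prim) : Prop :=
  (forall i, bounded_on T (fun t => W t i)) /\
  (forall t, 0 <= t <= T -> 0 < W t pRho) /\
  bounded_on T (fun t => / W t pRho).

Lemma speed_plus_bounded (T gam : R) (un bn : pvar) (WL WR : R -> prim) :
  regular_state T WL -> regular_state T WR ->
  bounded_on T (fun t => speed_plus gam un bn (WL t) (WR t)).
Proof.
  intros [hL [pL iL]] [hR [pR iR]].
  assert (hs : bounded_on T (fun t => / (sqrt (WL t pRho) + sqrt (WR t pRho)))).
  { apply bounded_dom with (g := fun t => sqrt (/ WL t pRho)).
    - intros t ht; rewrite sqrt_inv.
      pose proof (sqrt_lt_R0 _ (pL t ht)); pose proof (sqrt_lt_R0 _ (pR t ht)).
      rewrite !Rabs_pos_eq by (left; apply Rinv_0_lt_compat; lra).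
      apply Rinv_le_contravar; lra.
    - apply bounded_sqrt, iL. }
  unfold speed_plus, roe, beta, sound, b_sq, Rdiv.
  repeat first
    [ apply hL | apply hR | apply hs | apply bounded_const
    | apply bounded_inv_double; [exact iL]
    | apply bounded_inv_double; [exact iR]
    | apply bounded_max | apply bounded_min | apply bounded_plus
    | apply bounded_opp | apply bounded_mult | apply bounded_pow
    | apply bounded_sqrt ].
Qed.

Lemma speed_plus_ge0 (gam : R) (un bn : pvar) (WL WR : prim) :
  0 <= speed_plus gam un bn WL WR.
Proof.
  unfold speed_plus; eapply Rle_trans; [|apply Rmax_r]; apply Rmax_r.
Qed.

Lemma speed_minus_le0 (gam : R) (un bn : pvar) (WL WR : prim) :
  speed_minus gam un bn WL WR <= 0.
Proof.
  unfold speed_minus; eapply Rle_trans; [apply Rmin_r|]; apply Rmin_r.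
Qed.

(** The flux of [A + B] is linear in its interface values once the two states
    are given, with coefficients controlled by the velocities and [speed_plus];
    hence one constant serves for all times. *)
Lemma divergence_flux_bound (T gam : R) (un bn : pvar) (WL WR : R -> prim) :
  regular_state T WL -> regular_state T WR ->
  exists K, 0 <= K /\ forall t M (FL FR : cons), 0 <= t <= T ->
    FL cA + FL cB = WL t un * (WL t pA + WL t pB) ->
    FR cA + FR cB = WR t un * (WR t pA + WR t pB) ->
    Rabs (WL t pA + WL t pB) <= M -> Rabs (WR t pA + WR t pB) <= M ->
    let flux := cu_flux (speed_plus gam un bn (WL t) (WR t))
                  (speed_minus gam un bn (WL t) (WR t)) FL FR
                  (cons_of_prim gam (WL t)) (cons_of_prim gam (WR t)) in
    Rabs (flux cA + flux cB) <= K * M.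
Proof.
  intros hL hR.
  destruct (speed_plus_bounded T gam un bn WL WR hL hR) as [Ks hs].
  destruct (proj1 hL un) as [KL hKL]; destruct (proj1 hR un) as [KR hKR].
  exists (Rabs KL + Rabs KR + 2 * Rabs Ks); split.
  { pose proof (Rabs_pos KL); pose proof (Rabs_pos KR); pose proof (Rabs_pos Ks); lra. }
  intros t M FL FR ht eL eR dL dR flux.
  assert (hM : 0 <= M) by (eapply Rle_trans; [apply Rabs_pos | exact dL]).
  specialize (hs t ht); specialize (hKL t ht); specialize (hKR t ht).
  unfold flux, cu_flux; simpl.
  pose proof (speed_plus_ge0 gam un bn (WL t) (WR t)) as hp.
  pose proof (speed_minus_le0 gam un bn (WL t) (WR t)) as hm.
  set (sp := speed_plus _ _ _ _ _) in *; set (sm := speed_minus _ _ _ _ _) in *.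
  rewrite Rabs_pos_eq in hs by exact hp.
  match goal with |- Rabs ?X <= _ =>
    replace X with
      ((sp * (FL cA + FL cB) - sm * (FR cA + FR cB)) / (sp - sm)
       + sp * sm / (sp - sm) * ((WR t pA + WR t pB) - (WL t pA + WL t pB)))
      by (unfold Rdiv; ring)
  end.
  eapply Rle_trans; [apply central_upwind_bound; assumption|].
  rewrite eL, eR, !Rabs_mult.
  assert (h1 : Rabs (WL t un) * Rabs (WL t pA + WL t pB) <= Rabs KL * M).
  { apply Rmult_le_compat; try apply Rabs_pos; [|exact dL].
    eapply Rle_trans; [exact hKL | apply Rle_abs]. }
  assert (h2 : Rabs (WR t un) * Rabs (WR t pA + WR t pB) <= Rabs KR * M).
  { apply Rmult_le_compat; try apply Rabs_pos; [|exact dR].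
    eapply Rle_trans; [exact hKR | apply Rle_abs]. }
  assert (h3 : sp * (Rabs (WL t pA + WL t pB) + Rabs (WR t pA + WR t pB))
               <= Rabs Ks * (2 * M)).
  { apply Rmult_le_compat; [exact hp | | | lra].
    - apply Rplus_le_le_0_compat; apply Rabs_pos.
    - eapply Rle_trans; [exact hs | apply Rle_abs]. }
  lra.
Qed.

(** * Ghost cells *)

Lemma ghost_index_in (bc : boundary) (n j : Z) :
  (0 < n)%Z -> (0 <= ghost_index bc n j < n)%Z.
Proof.
  intros hn; destruct bc; simpl; [apply Z.mod_pos_bound; exact hn | lia].
Qed.

Lemma ghost_index_id (bc : boundary) (n j : Z) :
  (0 <= j < n)%Z -> ghost_index bc n j = j.
Proof. intros hj; destruct bc; simpl; [apply Z.mod_small; exact hj | lia]. Qed.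

Lemma ghost_in_mesh (S : setup) (j k : Z) :
  in_mesh S (ghost_index (bcx S) (nx S) j) (ghost_index (bcy S) (ny S) k).
Proof. split; apply ghost_index_in; [apply nx_gt0 | apply ny_gt0]. Qed.

Lemma extend_in_mesh (S : setup) (V : grid) (j k : Z) :
  in_mesh S j k -> extend S V j k = V j k.
Proof.
  intros [hj hk]; unfold extend; rewrite !ghost_index_id by assumption; reflexivity.
Qed.

Lemma cell_W_ghost_x (S : setup) (V : grid) (j k : Z) :
  cell_W S V (ghost_index (bcx S) (nx S) j) k = cell_W S V j k.
Proof.
  unfold cell_W, extend.
  rewrite (ghost_index_id _ _ (ghost_index _ _ _)); [reflexivity|].
  apply ghost_index_in, nx_gt0.
Qed.

Lemma cell_W_ghost_y (S : setup) (V : grid) (j k : Z) :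
  cell_W S V j (ghost_index (bcy S) (ny S) k) = cell_W S V j k.
Proof.
  unfold cell_W, extend.
  rewrite (ghost_index_id _ _ (ghost_index _ _ k)); [reflexivity|].
  apply ghost_index_in, ny_gt0.
Qed.

Lemma density_positive (S : setup) (V : grid) (j k : Z) :
  admissible S V -> 0 < cell_W S V j k pRho.
Proof.
  intros h; rewrite <- cell_W_ghost_x, <- cell_W_ghost_y.
  apply h, ghost_in_mesh.
Qed.

Lemma minmod_x_ghost (S : setup) (V : grid) (i : pvar) (j k : Z) :
  minmod_x S V i j k
  = minmod_x S V i (ghost_index (bcx S) (nx S) j) (ghost_index (bcy S) (ny S) k)
  \/ minmod_x S V i j k = 0.
Proof.
  unfold minmod_x; rewrite ?cell_W_ghost_y.
  exact (minmod_slope_ghost (theta S) (dx S) (bcx S) (nx S) j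
    (fun l => prim_of_cons (gamma S) (V l (ghost_index (bcy S) (ny S) k)) i)
    (nx_gt0 S)).
Qed.

Lemma minmod_y_ghost (S : setup) (V : grid) (i : pvar) (j k : Z) :
  minmod_y S V i j k
  = minmod_y S V i (ghost_index (bcx S) (nx S) j) (ghost_index (bcy S) (ny S) k)
  \/ minmod_y S V i j k = 0.
Proof.
  unfold minmod_y; rewrite ?cell_W_ghost_x.
  exact (minmod_slope_ghost (theta S) (dy S) (bcy S) (ny S) k
    (fun l => prim_of_cons (gamma S) (V (ghost_index (bcx S) (nx S) j) l) i)
    (ny_gt0 S)).
Qed.

(** Admissibility speaks of mesh cells only, while the interfaces on the border
    of the mesh involve reconstructions in ghost cells. *)
Lemma density_positive_x (S : setup) (V : grid) (j k : Z) :
  admissible S V -> 0 < W_E S V j k pRho /\ 0 < W_W S V j k pRho.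
Proof.
  intros h; pose proof (density_positive S V j k h) as h0.
  destruct (h _ _ (ghost_in_mesh S j k)) as [_ [[hE _] [[hW _] _]]].
  unfold W_E, W_W in *; simpl slope_x in *.
  rewrite cell_W_ghost_x, cell_W_ghost_y in *.
  destruct (minmod_x_ghost S V pRho j k) as [e|e]; rewrite e; [auto | lra].
Qed.

Lemma density_positive_y (S : setup) (V : grid) (j k : Z) :
  admissible S V -> 0 < W_N S V j k pRho /\ 0 < W_S S V j k pRho.
Proof.
  intros h; pose proof (density_positive S V j k h) as h0.
  destruct (h _ _ (ghost_in_mesh S j k)) as [_ [_ [_ [[hN _] [hS _]]]]].
  unfold W_N, W_S in *; simpl slope_y in *.
  rewrite cell_W_ghost_x, cell_W_ghost_y in *.
  destruct (minmod_y_ghost S V pRho j k) as [e|e]; rewrite e; [auto | lra].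
Qed.

(** * Regularity of the reconstruction along a solution *)

Lemma extend_continuous (S : setup) (T : R) (U : R -> grid) (j k : Z) (i : cvar) (t : R) :
  0 <= T -> is_solution S T U ->
  continuous (fun s => extend S (U (clamp T s)) j k i) t.
Proof.
  intros hT [_ hU].
  exact (C1_on_continuous T _ _ t hT (hU _ _ i (ghost_in_mesh S j k))).
Qed.

Lemma cell_W_bounded (S : setup) (T : R) (U : R -> grid) (j k : Z) (i : pvar) :
  0 <= T -> is_solution S T U -> bounded_on T (fun t => cell_W S (U t) j k i).
Proof.
  intros hT hU.
  assert (hb : forall l, bounded_on T (fun t => extend S (U t) j k l)).
  { intros l; apply continuous_bounded; [exact hT|].
    intros t; apply extend_continuous; assumption. }
  assert (hi : bounded_on T (fun t => / extend S (U t) j k cRho)).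
  { apply inverse_bounded; [exact hT | intros t; apply extend_continuous; assumption |].
    intros t ht; apply (density_positive S (U t) j k), (proj1 hU), ht. }
  destruct i; simpl; try apply hb; unfold pressure, Rdiv;
  repeat first
    [ apply hb | apply hi | apply bounded_const | apply bounded_plus
    | apply bounded_opp | apply bounded_mult | apply bounded_pow ].
Qed.

Lemma limiter_ge0 (h a : R) : 0 <= limiter h a.
Proof.
  unfold limiter; destruct (Rlt_dec 0 (h * a)) as [hp|]; [|lra].
  apply Rmin_glb; [lra|].
  assert (ha : a <> 0) by (intros ->; lra).
  replace (h / a) with ((h * a) * / (a * a)) by (field; exact ha).
  apply Rmult_le_pos; [lra|].
  left; apply Rinv_0_lt_compat; nra.
Qed.

Lemma sigma_bounds (S : setup) (V : grid) (j k : Z) : 0 <= Defs.sigma S V j k <= 1.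
Proof.
  unfold Defs.sigma; split; [|apply Rmin_l].
  apply Rmin_glb; [lra | apply Rmin_glb; apply limiter_ge0].
Qed.

Lemma sigma_scaled_bounded (S : setup) (T : R) (U : R -> grid) (j k : Z) (f : R -> R) :
  bounded_on T f -> bounded_on T (fun t => Defs.sigma S (U t) j k * f t).
Proof.
  apply bounded_dom; intros t _.
  rewrite Rabs_mult, (Rabs_pos_eq (Defs.sigma _ _ _ _)) by apply sigma_bounds.
  pose proof (sigma_bounds S (U t) j k); pose proof (Rabs_pos (f t)); nra.
Qed.

(** The limiter sigma may jump in time, where A or B vanishes. So the
    exceptional slopes need not be continuous in time, but they stay bounded
    because sigma takes values in [0, 1]. *)
Lemma slope_x_bounded (S : setup) (T : R) (U : R -> grid) (j k : Z) (i : pvar) :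
  0 <= T -> is_solution S T U -> bounded_on T (fun t => slope_x S (U t) i j k).
Proof.
  intros hT hU.
  assert (hm : forall l, bounded_on T (fun t => minmod_x S (U t) l j k)).
  { intros l.
    apply (minmod_slope_bounded T (theta S) (dx S) (fun t j' => cell_W S (U t) j' k l)).
    intros; apply cell_W_bounded; assumption. }
  destruct i; simpl; try apply hm.
  apply sigma_scaled_bounded, (cell_W_bounded S T U j k pA); assumption.
Qed.

Lemma slope_y_bounded (S : setup) (T : R) (U : R -> grid) (j k : Z) (i : pvar) :
  0 <= T -> is_solution S T U -> bounded_on T (fun t => slope_y S (U t) i j k).
Proof.
  intros hT hU.
  assert (hm : forall l, bounded_on T (fun t => minmod_y S (U t) l j k)).
  { intros l.
    apply (minmod_slope_bounded T (theta S) (dy S) (fun t k' => cell_W S (U t) j k' l)).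
    intros; apply cell_W_bounded; assumption. }
  destruct i; simpl; try apply hm.
  apply sigma_scaled_bounded, (cell_W_bounded S T U j k pB); assumption.
Qed.

(** Continuity in time is asked of the density alone: it bounds [1 / rho], while
    boundedness suffices for the other components. *)
Lemma linear_state_regular (T c : R) (w s W : R -> prim) :
  0 <= T -> (forall t i, W t i = w t i + c * s t i) ->
  (forall i, bounded_on T (fun t => w t i)) ->
  (forall i, bounded_on T (fun t => s t i)) ->
  (forall t, continuous (fun r => w (clamp T r) pRho) t) ->
  (forall t, continuous (fun r => s (clamp T r) pRho) t) ->
  (forall t, 0 <= t <= T -> 0 < W t pRho) ->
  regular_state T W.
Proof.
  intros hT hW bw bs cw cs hp; split; [|split; [exact hp|]].
  - intros i; apply bounded_dom with (g := fun t => w t i + c * s t i).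
    + intros t _; rewrite hW; lra.
    + apply bounded_plus; [apply bw|].
      apply bounded_mult; [apply bounded_const | apply bs].
  - apply inverse_bounded; [exact hT | | exact hp].
    intros t; apply continuous_ext with
      (f := fun r => w (clamp T r) pRho + c * s (clamp T r) pRho).
    + intros r; symmetry; apply hW.
    + apply (continuous_plus (fun r => w (clamp T r) pRho)); [apply cw|].
      apply (continuous_mult (fun _ => c)); [apply continuous_const | apply cs].
Qed.

Lemma interface_regular_x (S : setup) (T : R) (U : R -> grid) (j k : Z) :
  0 <= T -> is_solution S T U ->
  regular_state T (fun t => W_E S (U t) j k) /\
  regular_state T (fun t => W_W S (U t) j k).
Proof.
  intros hT hU.
  assert (hc : forall l t, continuous (fun r => cell_W S (U (clamp T r)) l k pRho) t)
    by (intros; apply extend_continuous; assumption).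
  assert (hs : forall t, continuous (fun r => slope_x S (U (clamp T r)) pRho j k) t).
  { intros t; apply (minmod_slope_continuous (theta S) (dx S)
      (fun r j' => cell_W S (U (clamp T r)) j' k pRho)); intros; apply hc. }
  assert (hp : forall t, 0 <= t <= T ->
            0 < W_E S (U t) j k pRho /\ 0 < W_W S (U t) j k pRho)
    by (intros t ht; apply density_positive_x, (proj1 hU), ht).
  split.
  - apply (linear_state_regular T (dx S / 2) (fun t => cell_W S (U t) j k)
             (fun t i => slope_x S (U t) i j k)); auto.
    + intros; apply cell_W_bounded; assumption.
    + intros; apply slope_x_bounded; assumption.
    + intros t ht; apply hp, ht.
  - apply (linear_state_regular T (- (dx S / 2)) (fun t => cell_W S (U t) j k)
             (fun t i => slope_x S (U t) i j k)); auto.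
    + intros; unfold W_W; ring.
    + intros; apply cell_W_bounded; assumption.
    + intros; apply slope_x_bounded; assumption.
    + intros t ht; apply hp, ht.
Qed.

Lemma interface_regular_y (S : setup) (T : R) (U : R -> grid) (j k : Z) :
  0 <= T -> is_solution S T U ->
  regular_state T (fun t => W_N S (U t) j k) /\
  regular_state T (fun t => W_S S (U t) j k).
Proof.
  intros hT hU.
  assert (hc : forall l t, continuous (fun r => cell_W S (U (clamp T r)) j l pRho) t)
    by (intros; apply extend_continuous; assumption).
  assert (hs : forall t, continuous (fun r => slope_y S (U (clamp T r)) pRho j k) t).
  { intros t; apply (minmod_slope_continuous (theta S) (dy S)
      (fun r k' => cell_W S (U (clamp T r)) j k' pRho)); intros; apply hc. }
  assert (hp : forall t, 0 <= t <= T ->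
            0 < W_N S (U t) j k pRho /\ 0 < W_S S (U t) j k pRho)
    by (intros t ht; apply density_positive_y, (proj1 hU), ht).
  split.
  - apply (linear_state_regular T (dy S / 2) (fun t => cell_W S (U t) j k)
             (fun t i => slope_y S (U t) i j k)); auto.
    + intros; apply cell_W_bounded; assumption.
    + intros; apply slope_y_bounded; assumption.
    + intros t ht; apply hp, ht.
  - apply (linear_state_regular T (- (dy S / 2)) (fun t => cell_W S (U t) j k)
             (fun t i => slope_y S (U t) i j k)); auto.
    + intros; unfold W_S; ring.
    + intros; apply cell_W_bounded; assumption.
    + intros; apply slope_y_bounded; assumption.
    + intros t ht; apply hp, ht.
Qed.

(** * The evolution of A + B *)

Definition divergence (V : grid) (j k : Z) : R := V j k cA + V j k cB.

Definition divergence_le (S : setup) (V : grid) (M : R) : Prop :=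
  forall j k, in_mesh S j k -> Rabs (divergence V j k) <= M.

Lemma interface_divergence_x (S : setup) (V : grid) (M : R) (j k : Z) :
  divergence_le S V M ->
  Rabs (W_E S V j k pA + W_E S V j k pB) <= (2 * theta S + 2) * M /\
  Rabs (W_W S V j k pA + W_W S V j k pB) <= (2 * theta S + 2) * M.
Proof.
  intros hV.
  pose proof (dx_gt0 S) as hd.
  assert (hw : forall l, Rabs (cell_W S V l k pA + cell_W S V l k pB) <= M)
    by (intros l; apply hV, ghost_in_mesh).
  pose proof (fun c e => interface_nearly_opposite (theta S) (dx S) c M
    (fun l => cell_W S V l k pA) (fun l => cell_W S V l k pB) j
    (theta_gt0 S) hd e hw) as H.
  split.
  - apply (H (dx S / 2)); apply Rabs_pos_eq; lra.
  - assert (e : Rabs (- (dx S / 2)) = dx S / 2) by (rewrite Rabs_Ropp; apply Rabs_pos_eq; lra).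
    specialize (H _ e).
    rewrite !Ropp_mult_distr_l_reverse in H; exact H.
Qed.

Lemma interface_divergence_y (S : setup) (V : grid) (M : R) (j k : Z) :
  divergence_le S V M ->
  Rabs (W_N S V j k pA + W_N S V j k pB) <= (2 * theta S + 2) * M /\
  Rabs (W_S S V j k pA + W_S S V j k pB) <= (2 * theta S + 2) * M.
Proof.
  intros hV.
  pose proof (dy_gt0 S) as hd.
  assert (hw : forall l, Rabs (cell_W S V j l pA + cell_W S V j l pB) <= M)
    by (intros l; apply hV, ghost_in_mesh).
  pose proof (fun c e => interface_nearly_opposite (theta S) (dy S) c M
    (fun l => cell_W S V j l pA) (fun l => cell_W S V j l pB) k
    (theta_gt0 S) hd e hw) as H.
  split.
  - apply (H (dy S / 2)); apply Rabs_pos_eq; lra.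
  - assert (e : Rabs (- (dy S / 2)) = dy S / 2) by (rewrite Rabs_Ropp; apply Rabs_pos_eq; lra).
    specialize (H _ e).
    rewrite !Ropp_mult_distr_l_reverse in H; exact H.
Qed.

Lemma num_flux_x_bound (S : setup) (T : R) (U : R -> grid) (j k : Z) :
  0 <= T -> is_solution S T U ->
  exists K, 0 <= K /\ forall t M, 0 <= t <= T -> divergence_le S (U t) M ->
    Rabs (num_flux_x S (U t) j k cA + num_flux_x S (U t) j k cB) <= K * M.
Proof.
  intros hT hU.
  destruct (interface_regular_x S T U j k hT hU) as [hL _].
  destruct (interface_regular_x S T U (j + 1) k hT hU) as [_ hR].
  destruct (divergence_flux_bound T (gamma S) pU pB1 _ _ hL hR) as [K [hK H]].
  pose proof (theta_gt0 S) as hth.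
  exists (K * (2 * theta S + 2)); split; [apply Rmult_le_pos; lra|].
  intros t M ht hM; rewrite Rmult_assoc.
  apply H; [exact ht | | | |].
  - apply flux_x_divergence, Rgt_not_eq, (proj1 (proj2 hL)), ht.
  - apply flux_x_divergence, Rgt_not_eq, (proj1 (proj2 hR)), ht.
  - apply interface_divergence_x, hM.
  - apply interface_divergence_x, hM.
Qed.

Lemma num_flux_y_bound (S : setup) (T : R) (U : R -> grid) (j k : Z) :
  0 <= T -> is_solution S T U ->
  exists K, 0 <= K /\ forall t M, 0 <= t <= T -> divergence_le S (U t) M ->
    Rabs (num_flux_y S (U t) j k cA + num_flux_y S (U t) j k cB) <= K * M.
Proof.
  intros hT hU.
  destruct (interface_regular_y S T U j k hT hU) as [hL _].
  destruct (interface_regular_y S T U j (k + 1) hT hU) as [_ hR].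
  destruct (divergence_flux_bound T (gamma S) pV pB2 _ _ hL hR) as [K [hK H]].
  pose proof (theta_gt0 S) as hth.
  exists (K * (2 * theta S + 2)); split; [apply Rmult_le_pos; lra|].
  intros t M ht hM; rewrite Rmult_assoc.
  apply H; [exact ht | | | |].
  - apply flux_y_divergence, Rgt_not_eq, (proj1 (proj2 hL)), ht.
  - apply flux_y_divergence, Rgt_not_eq, (proj1 (proj2 hR)), ht.
  - apply interface_divergence_y, hM.
  - apply interface_divergence_y, hM.
Qed.

Lemma RInt_zero (a b : R) : RInt (fun _ : R => 0) a b = 0.
Proof. rewrite RInt_const; apply Rmult_0_r. Qed.

(** The last two components of [qvec] vanish, so that no nonconservative term
    survives in the equation of [A + B]. *)
Lemma scheme_rhs_divergence (S : setup) (V : grid) (j k : Z) :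
  scheme_rhs S V j k cA + scheme_rhs S V j k cB
  = - / dx S * ((num_flux_x S V j k cA + num_flux_x S V j k cB)
                - (num_flux_x S V (j - 1) k cA + num_flux_x S V (j - 1) k cB))
    - / dy S * ((num_flux_y S V j k cA + num_flux_y S V j k cB)
                - (num_flux_y S V j (k - 1) cA + num_flux_y S V j (k - 1) cB)).
Proof.
  unfold scheme_rhs, Q_cell, R_cell, Q_psi, R_psi, path_integral; simpl qvec.
  rewrite !RInt_zero; ring.
Qed.

Lemma scheme_rhs_bound (S : setup) (T : R) (U : R -> grid) (j k : Z) :
  0 <= T -> is_solution S T U ->
  exists K, 0 <= K /\ forall t M, 0 <= t <= T -> divergence_le S (U t) M ->
    Rabs (scheme_rhs S (U t) j k cA + scheme_rhs S (U t) j k cB) <= K * M.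
Proof.
  intros hT hU.
  destruct (num_flux_x_bound S T U j k hT hU) as [K1 [p1 H1]].
  destruct (num_flux_x_bound S T U (j - 1) k hT hU) as [K2 [p2 H2]].
  destruct (num_flux_y_bound S T U j k hT hU) as [K3 [p3 H3]].
  destruct (num_flux_y_bound S T U j (k - 1) hT hU) as [K4 [p4 H4]].
  pose proof (Rinv_0_lt_compat _ (dx_gt0 S)) as hx.
  pose proof (Rinv_0_lt_compat _ (dy_gt0 S)) as hy.
  exists (/ dx S * (K1 + K2) + / dy S * (K3 + K4)); split.
  { apply Rplus_le_le_0_compat; apply Rmult_le_pos; lra. }
  intros t M ht hM; rewrite scheme_rhs_divergence.
  specialize (H1 t M ht hM); specialize (H2 t M ht hM);
    specialize (H3 t M ht hM); specialize (H4 t M ht hM).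
  assert (hd : forall c a b Ka Kb, 0 < c -> Rabs a <= Ka * M -> Rabs b <= Kb * M ->
            Rabs (c * (a - b)) <= c * ((Ka + Kb) * M)).
  { intros c a b Ka Kb hc ha hb.
    rewrite Rabs_mult, (Rabs_pos_eq c) by lra.
    apply Rmult_le_compat_l; [lra|].
    eapply Rle_trans; [apply Rabs_triang|]; rewrite Rabs_Ropp; lra. }
  pose proof (hd _ _ _ _ _ hx H1 H2) as hX.
  pose proof (hd _ _ _ _ _ hy H3 H4) as hY.
  unfold Rminus at 1; eapply Rle_trans; [apply Rabs_triang|].
  rewrite Ropp_mult_distr_l_reverse, !Rabs_Ropp; lra.
Qed.

(** * Uniformity over the mesh *)

Lemma uniform_bound_Z (n : Z) (P : Z -> R -> Prop) :
  (forall j K K', K <= K' -> P j K -> P j K') ->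
  (forall j, (0 <= j < n)%Z -> exists K, P j K) ->
  exists K, forall j, (0 <= j < n)%Z -> P j K.
Proof.
  intros hmono; destruct (Z.le_gt_cases n 0) as [hn|hn].
  { intros _; exists 0; intros j hj; lia. }
  assert (hn' : (0 <= n)%Z) by lia; clear hn; revert n hn'.
  apply (natlike_ind (fun n => (forall j, (0 <= j < n)%Z -> exists K, P j K) ->
    exists K, forall j, (0 <= j < n)%Z -> P j K)).
  - intros _; exists 0; intros j hj; lia.
  - intros n hn IH h.
    destruct IH as [K hK]; [intros j hj; apply h; lia|].
    destruct (h n) as [K' hK']; [lia|].
    exists (Rmax K K'); intros j hj.
    destruct (Z.eq_dec j n) as [->|hne].
    + apply hmono with (2 := hK'), Rmax_r.
    + apply hmono with (K := K); [apply Rmax_l | apply hK; lia].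
Qed.

Lemma uniform_bound_mesh (S : setup) (P : Z -> Z -> R -> Prop) :
  (forall j k K K', K <= K' -> P j k K -> P j k K') ->
  (forall j k, in_mesh S j k -> exists K, P j k K) ->
  exists K, forall j k, in_mesh S j k -> P j k K.
Proof.
  intros hmono h.
  destruct (uniform_bound_Z (nx S) (fun j K => forall k, (0 <= k < ny S)%Z -> P j k K))
    as [K hK].
  - intros j K K' hKK hP k hk; apply hmono with (1 := hKK); auto.
  - intros j hj; apply uniform_bound_Z; [intros k; apply hmono|].
    intros k hk; apply h; split; assumption.
  - exists K; intros j k [hj hk]; auto.
Qed.

(** The vector of all [A + B] satisfies a linear differential inequality, whose
    constant is uniform because the mesh is finite. *)
Lemma divergence_stays_zero (S : setup) (T : R) (U : R -> grid) :
  0 <= T -> is_solution S T U ->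
  (forall j k, in_mesh S j k -> divergence (U 0) j k = 0) ->
  forall t j k, 0 <= t <= T -> in_mesh S j k -> divergence (U t) j k = 0.
Proof.
  intros hT hU h0.
  assert (hC : forall j k, in_mesh S j k ->
    C1_on T (fun t => divergence (U t) j k)
      (fun t => scheme_rhs S (U t) j k cA + scheme_rhs S (U t) j k cB))
    by (intros j k hjk; apply C1_on_plus; apply (proj2 hU), hjk).
  destruct (uniform_bound_mesh S (fun j k K =>
    forall t, 0 <= t <= T -> Rabs (divergence (U t) j k) <= K)) as [M0 hM0].
  { intros j k K K' hKK h t ht; apply Rle_trans with (2 := hKK); auto. }
  { intros j k hjk; apply continuous_bounded; [exact hT|].
    intros t; exact (C1_on_continuous T _ _ t hT (hC j k hjk)). }
  destruct (uniform_bound_mesh S (fun j k K =>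
    forall t M, 0 <= t <= T -> divergence_le S (U t) M ->
      Rabs (scheme_rhs S (U t) j k cA + scheme_rhs S (U t) j k cB) <= K * M))
    as [K hK].
  { intros j k K K' hKK h t M ht hM.
    apply Rle_trans with (1 := h t M ht hM).
    apply Rmult_le_compat_r; [|exact hKK].
    pose proof (hM _ _ (ghost_in_mesh S 0 0)) as hm.
    eapply Rle_trans; [apply Rabs_pos | exact hm]. }
  { intros j k _; destruct (scheme_rhs_bound S T U j k hT hU) as [K [_ hK]].
    exists K; exact hK. }
  intros t j k ht hjk.
  apply (gronwall_family (Z * Z) (fun p => in_mesh S (fst p) (snd p)) T (Rmax 1 K) M0
    (fun p s => divergence (U s) (fst p) (snd p))
    (fun p s => scheme_rhs S (U s) (fst p) (snd p) cA
                + scheme_rhs S (U s) (fst p) (snd p) cB))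
    with (i := (j, k)); auto.
  - pose proof (Rmax_l 1 K); lra.
  - intros s M hs hM p hp.
    assert (hV : divergence_le S (U s) M)
      by (intros j' k' hjk'; apply (hM (j', k') hjk')).
    apply Rle_trans with (1 := hK _ _ hp s M hs hV).
    apply Rmult_le_compat_r; [|apply Rmax_r].
    eapply Rle_trans; [apply Rabs_pos | apply (hM p hp)].
Qed.

Theorem theorem2p1 (S : setup) (T : R) (U : R -> grid)
  (hU : is_solution S T U)
  (h0 : forall j k : Z, in_mesh S j k -> U 0 j k cA + U 0 j k cB = 0) :
  forall (t : R) (j k : Z), 0 <= t <= T -> in_mesh S j k ->
    slope_x S (U t) pB1 j k + slope_y S (U t) pB2 j k = 0.
Proof.
  intros t j k ht hjk.
  assert (hT : 0 <= T) by lra.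
  pose proof (divergence_stays_zero S T U hT hU h0 t j k ht hjk) as hD.
  simpl; rewrite extend_in_mesh by exact hjk.
  unfold divergence in hD.
  rewrite <- Rmult_plus_distr_l, hD; ring.
Qed.
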